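(* Let $\mathcal F$ be the class of laws on which a summary map $\Psi:\mathcal F\to E$ is defined, and let $\Psi_m:\mathcal F\to E_m$ be a finite-rank or discretized approximation to $\Psi$, where $(E,\|\cdot\|_E)$ is a Banach space and $(E_m,\|\cdot\|_{E_m})$ a normed space. Suppose there exist an isometric embedding $\iota_m:E_m\to E$ and a model class $\mathcal G\subseteq\mathcal F$ such that $$\sup_{\nu\in\mathcal G}\|\iota_m\Psi_m(\nu)-\Psi(\nu)\|_E\le a_m .$$ Let $\nu_{t,z}=\mathcal L(Y\mid T=t,Z=z)$, $P_{t,z}=\mathcal L(Y(t)\mid Z=z)$ and $\theta_\Psi(z)=\|\Psi(P_{1,z})-\Psi(P_{0,z})\|_E$, and assume conditional topological ignorability relative to $\Psi$, so that $\Psi(P_{t,z})=\Psi(\nu_{t,z})$ for $t=0,1$ and $P_Z$-a.e. $z$. Then for every $z$ with $\nu_{0,z},\nu_{1,z}\in\mathcal G$ (at which these equalities hold), $$\Bigl|\,\|\Psi_m(\nu_{1,z})-\Psi_m(\nu_{0,z})\|_{E_m}-\theta_\Psi(z)\Bigr|\le 2a_m .$$ Consequently, $$|\tau_{\Psi_m}-\tau_\Psi|\le 2a_m,\qquad \tau_{\Psi_m}:=\mathbb E\bigl[\|\Psi_m(\nu_{1,Z})-\Psi_m(\nu_{0,Z})\|_{E_m}\bigr],$$ where $\tau_\Psi:=\mathbb E[\theta_\Psi(Z)]$.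
   Context: $T\in\{0,1\}$ is a treatment, $Z$ a covariate in a standard Borel space with law $P_Z$, $Y(0),Y(1)$ are potential outcomes in $\mathcal Y\subseteq\mathbb R^d$, and $Y=Y(T)$ a.s. (consistency), so $\nu_{t,z}=\mathcal L(Y(t)\mid T=t,Z=z)$. Positivity holds: $0<\mathbb P(T=1\mid Z=z)<1$ for a.e. $z$. Conditional topological ignorability relative to $\Psi$ means $\Psi(\mathcal L(Y(t)\mid T=t,Z=z))=\Psi(P_{t,z})$ for $t\in\{0,1\}$ and $P_Z$-a.e. $z$. Laws $\mu$ have densities $f_\mu$ with respect to a common $\sigma$-finite measure and $\Psi(\mu)=\Phi(f_\mu)$ for a measurable map $\Phi$ from densities into $E$. An isometric embedding satisfies $\|\iota_m x-\iota_m y\|_E=\|x-y\|_{E_m}$ for all $x,y\in E_m$.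
   Formalization: The bound on the averaged effects is stated under the added assumptions that the laws ν_{0,z}, ν_{1,z} lie in the model class for P_Z-a.e. z and that at least one of the two expectations is finite; without them it is false or undefined. *)

(* Defs.v *)
From HB Require Import structures.
From mathcomp Require Import all_boot all_order all_algebra.
From mathcomp Require Import all_classical all_reals all_analysis.

Set Implicit Arguments.
Unset Strict Implicit.
Unset Printing Implicit Defensive.

Import Order.TTheory GRing.Theory Num.Theory.
Import numFieldNormedType.Exports.

Local Open Scope classical_set_scope.
Local Open Scope ring_scope.

(* The measurable sets are the Borel sets of some Polish topology: the
   bijection f transports the topology of a separable complete metric space
   (a Hausdorff complete pseudometric one). *)
Definition standard_borel (R : realType) d (T : measurableType d) : Prop :=
  exists (X : completePseudoMetricType R) (f : T -> X),
    [/\ hausdorff_space X,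
        (exists2 D : set X, countable D & dense D),
        bijective f &
        forall A : set X, measurable (f @^-1` A) <-> <<s @open X >> A].

(* A nonempty subset of R^n with its trace Borel sigma-algebra, given as a type
   with its inclusion. The subset itself, range incl, need not be Borel. *)
Definition measurable_subspace d d' (T : measurableType d)
    (U : measurableType d') (incl : T -> U) : Prop :=
  injective incl /\
  @measurable d T = preimage_set_system setT incl (@measurable d' U).

(* kappa is a version of the regular conditional law of X given W. *)
Definition cond_law (R : realType) d d1 d2 (Omega : measurableType d)
    (T1 : measurableType d1) (T2 : measurableType d2)
    (Pr : probability Omega R) (X : Omega -> T2) (W : Omega -> T1)
    (kappa : T1 -> pprobability T2 R) : Prop :=
  measurable_fun setT kappa /\
  forall (A : set T1) (B : set T2), measurable A -> measurable B ->
    Pr (W @^-1` A `&` X @^-1` B) =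
    (\int[Pr]_(w in W @^-1` A) kappa (W w) B)%E.

Definition densities (R : realType) d (T : measurableType d)
    (lam : {sigma_finite_measure set T -> \bar R}) : set (T -> R) :=
  [set f : T -> R | [/\ measurable_fun setT f, (forall y, 0 <= f y) &
               (\int[lam]_y (f y)%:E = 1)%E]].

(* Every law mu of the class F has the density dens mu with respect to lam, and
   Psi mu = Phi (dens mu) with Phi measurable from the space of densities to E
   with its Borel sets. The sigma-algebra S on densities is arbitrary. *)
Definition density_functional (R : realType) d (T : measurableType d)
    (E : normedModType R) (lam : {sigma_finite_measure set T -> \bar R})
    (S : set (set (T -> R))) (Phi : (T -> R) -> E)
    (dens : probability T R -> T -> R)
    (F : set (probability T R)) (Psi : probability T R -> E) : Prop :=
  [/\ sigma_algebra (densities lam) S,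
      (forall B : set E, <<s @open E >> B ->
         S (densities lam `&` Phi @^-1` B)) &
      forall mu, F mu ->
        [/\ densities lam (dens mu),
            (forall B, measurable B ->
               mu B = (\int[lam]_(y in B) (dens mu y)%:E)%E) &
            Psi mu = Phi (dens mu)]].

(* A map on a class F of laws is represented by a total function, whose values
   outside F are meaningless: equality of summaries therefore includes that
   both laws belong to F. *)
Definition same_summary (R : realType) d (T : measurableType d)
    (E : normedModType R) (F : set (probability T R))
    (Psi : probability T R -> E) (mu mu' : probability T R) : Prop :=
  [/\ F mu, F mu' & Psi mu = Psi mu'].

Definition isometric_embedding (R : realType) (E1 E2 : normedModType R)
    (f : E1 -> E2) : Prop :=
  forall x y, `|f x - f y| = `|x - y|.

Definition effect (R : realType) d d' (Z : measurableType d)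
    (T : measurableType d') (E : normedModType R)
    (Psi : probability T R -> E) (kappa : bool -> Z -> probability T R)
    (z : Z) : R :=
  `|Psi (kappa true z) - Psi (kappa false z)|.

(* Main.v *)
(** Ignorability lets both effects be written with the laws nu, and the isometry
    moves the approximate effect into E, so that two applications of the triangle
    inequality give the pointwise bound. The composites with Z need not be
    measurable, and their expectations are then lower integrals, which are not
    additive; a shift by a constant is nevertheless compatible with them. *)
Require Import Defs.
From HB Require Import structures.
From mathcomp Require Import all_boot all_order all_algebra.
From mathcomp Require Import all_classical all_reals all_analysis.
From mathcomp Require Import measurable_realfun.

Import Order.TTheory GRing.Theory Num.Theory.
Import numFieldNormedType.Exports.
Import HBNNSimple.

Local Open Scope classical_set_scope.
Local Open Scope ring_scope.

(** The integral of a nonnegative function is the supremum of the integrals of the simple functions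
    below it, and those below [f] are also below [g]; neither function has to be measurable. *)
Lemma ge0_le_lower_integral (R : realType) d (T : measurableType d)
    (mu : {measure set T -> \bar R}) (f g : T -> \bar R) :
  (forall x, 0 <= f x)%E -> (forall x, f x <= g x)%E ->
  (\int[mu]_x f x <= \int[mu]_x g x)%E.
Proof.
move=> f0 fg; have g0 x : (0 <= g x)%E by exact: le_trans (fg x).
rewrite !ge0_integralTE//; apply: le_ereal_sup => _ [h /= hf <-].
by exists h => //= x; exact: le_trans (fg x).
Qed.

Lemma ae_le_lower_integral_shift (R : realType) d (T : measurableType d)
    (P : probability T R) (f g : T -> R) (c : R) :
  (forall x, 0 <= f x) -> (forall x, 0 <= g x) -> 0 <= c ->
  {ae P, forall x, f x <= g x + c} ->
  (\int[P]_x (f x)%:E <= \int[P]_x (g x)%:E + c%:E)%E.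
Proof.
move=> f0 g0 c0 [N [mN PN fgN]].
rewrite ge0_integralTE; last by move=> x; rewrite lee_fin.
apply: ge_ereal_sup => _ [h /= hf <-]; rewrite -integralT_nnsfun.
(* A simple function h <= f is replaced by the measurable function
   (h - c)^+ outside N, which lies below g everywhere. *)
pose k x := \1_(~` N) x * Num.max (h x - c) 0.
have k0 x : 0 <= k x by rewrite mulr_ge0// le_max lexx orbT.
have mk : measurable_fun setT k.
  apply: measurable_funM; first exact/measurable_indic/measurableC.
  apply: measurable_maxr => //; exact: measurable_funB.
have kg x : k x <= g x.
  rewrite /k indicE; case: (boolP (x \in ~` N)) => [|_]; last by rewrite mul0r.
  rewrite inE => xN; rewrite mul1r ge_max g0 andbT lerBlDr.
  apply: (@le_trans _ _ (f x)); first by rewrite -lee_fin hf.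
  by apply: contrapT => xfg; apply: xN; exact: fgN.
(* Off [N], [k + c] is [max(h - c, 0) + c], hence at least [h]. *)
apply: (@le_trans _ _ (\int[P]_x ((k x)%:E + c%:E))%E).
  apply: ae_ge0_le_integral => //.
  - by move=> x _; rewrite lee_fin.
  - exact/measurable_EFinP.
  - by move=> x _; rewrite adde_ge0// lee_fin.
  - by apply: emeasurable_funD => //; exact/measurable_EFinP.
  exists N; split=> // x /=; apply: contra_notP => xN _.
  rewrite -EFinD lee_fin /k indicE mem_set// mul1r -lerBlDr.
  by rewrite le_max lexx.
(* Additivity is legitimate here, since [k] and the constant are measurable; the constant integrates
   to [c] because [P] has mass one. *)
rewrite ge0_integralD//; last 2 first.
- by move=> x _; rewrite lee_fin.
- exact/measurable_EFinP.
rewrite integral_cst//= probability_setT mule1 leeD2r//.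
by apply: ge0_le_lower_integral => x; rewrite lee_fin.
Qed.

(** The preimage under [X] of a null set for the law of [X] is null for [P], by definition of the
    law. *)
Lemma ae_distribution (R : realType) d d' (T : measurableType d)
    (U : measurableType d') (P : probability T R) (X : {RV P >-> U})
    (Q : U -> Prop) :
  {ae distribution P X, forall u, Q u} -> {ae P, forall w, Q (X w)}.
Proof.
move=> [N [mN PN QN]]; exists (X @^-1` N); split => //.
- by rewrite -[X @^-1` N]setTI; exact: measurable_funP.
- by move=> w /= QXw; exact: QN.
Qed.

(** If one of [x], [y] is finite, the two inequalities make the other finite. The case excluded is
    [+oo - +oo], which has the default value [-oo] and so an infinite absolute value. *)
Lemma lee_abs_sub_of_le_add (R : realType) (x y : \bar R) (c : R) :
  (0 <= x)%E -> (0 <= y)%E -> (x < +oo \/ y < +oo)%E ->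
  (x <= y + c%:E)%E -> (y <= x + c%:E)%E -> (`|x - y| <= c%:E)%E.
Proof.
case: x => [x| |]; case: y => [y| |] // _ _; rewrite ?ltxx.
- move=> _; rewrite -EFinB -!EFinD abse_EFin !lee_fin => xy yx.
  by rewrite ler_norml lerBlDr [c + y]addrC xy andbT lerNl opprB lerBlDr addrC.
- by case.
Qed.

(** The reverse triangle inequality reduces the claim to the norm of [(u - x) - (v - y)]; each
    difference costs one [b], whence the factor 2. *)
Lemma norm_dist_perturb (R : realType) (E : normedModType R) (x y u v : E)
    (b : R) :
  `|u - x| <= b -> `|v - y| <= b -> `| `|u - v| - `|x - y| | <= 2 * b.
Proof.
move=> ux vy; apply: (le_trans (ler_dist_dist _ _)).
rewrite (_ : u - v - (x - y) = (u - x) - (v - y)).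
  by rewrite mulr_natl mulr2n (le_trans (ler_normB _ _))// lerD.
by rewrite !opprB [LHS]addrACA [RHS]addrACA [- v - x]addrC.
Qed.

Theorem proposition23 (R : realType)
  (dO dZ dY : measure_display) (n : nat)
  (Omega : measurableType dO) (Pr : probability Omega R)
  (ZT : measurableType dZ) (hZT : standard_borel R ZT)
  (YT : measurableType dY) (incl : YT -> n.-tuple R)
  (hYT : measurable_subspace incl)
  (T : {RV Pr >-> bool}) (Z : {RV Pr >-> ZT})
  (Ypot : bool -> {RV Pr >-> YT}) (Y : {RV Pr >-> YT})
  (consistency : {ae Pr, forall w, Y w = Ypot (T w) w})
  (propensity : ZT -> pprobability bool R)
  (hpropensity : cond_law Pr T Z propensity)
  (positivity : {ae distribution Pr Z,
     forall z, (0 < propensity z [set true] < 1)%E})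
  (nu : bool -> ZT -> probability YT R)
  (hnu : cond_law Pr Y (fun w => (T w, Z w)) (fun tz => nu tz.1 tz.2))
  (Pt : bool -> ZT -> probability YT R)
  (hPt : forall t : bool, cond_law Pr (Ypot t) Z (Pt t))
  (E : completeNormedModType R) (Em : normedModType R)
  (F : set (probability YT R))
  (Psi : probability YT R -> E) (Psim : probability YT R -> Em)
  (lam : {sigma_finite_measure set YT -> \bar R})
  (S : set (set (YT -> R))) (Phi : (YT -> R) -> E)
  (dens : probability YT R -> YT -> R)
  (hPsi : density_functional lam S Phi dens F Psi)
  (iota : Em -> E) (hiota : isometric_embedding iota)
  (G : set (probability YT R)) (GF : G `<=` F) (a : R)
  (hG : (ereal_sup [set `|iota (Psim mu) - Psi mu|%:E | mu in G] <= a%:E)%E)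
  (ignorability : {ae distribution Pr Z, forall z,
     forall t : bool, same_summary F Psi (Pt t z) (nu t z)}) :
  (forall z : ZT, G (nu false z) -> G (nu true z) ->
     (forall t : bool, same_summary F Psi (Pt t z) (nu t z)) ->
     `|effect Psim nu z - effect Psi Pt z| <= 2 * a)
  /\
  ({ae distribution Pr Z, forall z, G (nu false z) /\ G (nu true z)} ->
   ('E_Pr[effect Psi Pt \o Z] < +oo \/ 'E_Pr[effect Psim nu \o Z] < +oo)%E ->
   (`| 'E_Pr[effect Psim nu \o Z] - 'E_Pr[effect Psi Pt \o Z] | <=
      (2 * a)%:E)%E).
Proof.
have approx mu : G mu -> `|iota (Psim mu) - Psi mu| <= a.
  move=> Gmu; rewrite -lee_fin; apply: le_trans hG.
  by apply: ereal_sup_ubound; exists mu.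
have bound z : G (nu false z) -> G (nu true z) ->
    (forall t : bool, same_summary F Psi (Pt t z) (nu t z)) ->
    `|effect Psim nu z - effect Psi Pt z| <= 2 * a.
  move=> G0 G1 ign; have [_ _ P0] := ign false; have [_ _ P1] := ign true.
  by rewrite /effect P0 P1 -hiota; apply: norm_dist_perturb; exact: approx.
split=> // aeG fin.
(* The exceptional sets lie in the space of [Z], whereas the expectations are taken over [Omega]. *)
have ae_bound : {ae Pr, forall w,
    `|effect Psim nu (Z w) - effect Psi Pt (Z w)| <= 2 * a}.
  apply: (@ae_distribution _ _ _ _ _ _ Z
    (fun z => `|effect Psim nu z - effect Psi Pt z| <= 2 * a)).
  by apply: filterS2 aeG ignorability => z [G0 G1]; exact: bound.
(* If [G] is empty, the supremum is [-oo] and says nothing about the sign of [a]. The sign comes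
   from an outcome where the almost sure bound holds; one exists because [Pr] has positive mass. *)
have a0 : 0 <= 2 * a.
  have proper : ProperFilter (almost_everywhere Pr).
    apply: ae_properfilter_algebraOfSetsType.
    by rewrite [X in (_ < X)%E]probability_setT.
  by have [w] := @filter_ex _ _ proper _ ae_bound; exact: le_trans.
rewrite expectation.unlock in fin *.
apply: lee_abs_sub_of_le_add.
- by apply: integral_ge0 => w _; rewrite lee_fin; exact: normr_ge0.
- by apply: integral_ge0 => w _; rewrite lee_fin; exact: normr_ge0.
- by case: fin; [right|left].
(* The two remaining goals use the two one-sided halves of [ae_bound]. *)
- apply: ae_le_lower_integral_shift => // [w|w|]; [exact: normr_ge0..|].
  apply: filterS ae_bound => w; exact: ler_distlDr.
- apply: ae_le_lower_integral_shift => // [w|w|]; [exact: normr_ge0..|].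
  apply: filterS ae_bound => w; exact: ler_distlCDr.
Qed.
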